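(* For all cardinal numbers $\lambda\ge 2$ and $\kappa\ge 1$, ${\sf L}(\lambda,\kappa)$ implies ${\sf D}(\lambda,\kappa)$.
   Context: Gale-Stewart games: for cardinals $\lambda\ge 2$, $\kappa\ge 1$ and a set $A\subseteq{}^{\omega}\lambda$, the game ${\sf GS}_{\lambda}(A,\kappa)$ has one inning per $n<\omega$. In inning $n$ player ONE first selects $f_{2n}\in{}^{\kappa}\lambda$, then player TWO responds with $f_{2n+1}\in{}^{\kappa}\lambda$. ONE wins the play $(f_n:n<\omega)$ if there is an $\alpha<\kappa$ with $(f_n(\alpha):n<\omega)\in A$; otherwise TWO wins. ${\sf GS}_{\lambda}(A)$ denotes ${\sf GS}_{\lambda}(A,1)$, i.e. the classical game in which the players alternately choose $\xi_0,\xi_1,\xi_2,\dots\in\lambda$ (ONE moving first) and ONE wins iff $(\xi_n:n<\omega)\in A$. A game is determined if one of the players has a winning strategy. ${\sf D}(\lambda,\kappa)$ is the statement: for each set $A\subseteq{}^{\omega}\lambda$ the game ${\sf GS}_{\lambda}(A,\kappa)$ is determined. Laver game: in ${\sf LG}(\lambda,\kappa)$ player ONE chooses $f_0:\kappa\to\lambda$, then TWO chooses $f_1:\kappa\to\lambda$, then ONE chooses $f_2:\kappa\to\lambda$, and so on for $\omega$ moves. ONE wins the play $(f_0,f_1,f_2,\dots)$ if for each $S\subseteq{}^{\omega}\lambda$ such that TWO does not have a winning strategy in ${\sf GS}_{\lambda}(S)$ there exists $\xi\in\kappa$ such that $(f_0(\xi),f_1(\xi),f_2(\xi),\dots)\in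 S$. Otherwise TWO wins. ${\sf L}(\lambda,\kappa)$ is the statement: ONE has a winning strategy in ${\sf LG}(\lambda,\kappa)$. *)

(* Defs.v *)
From mathcomp Require Import all_boot.
From mathcomp Require Import mathcomp_extra boolp classical_sets functions.
From mathcomp Require Import cardinality.

Set Implicit Arguments.
Unset Strict Implicit.
Unset Printing Implicit Defensive.

(* Cardinals lambda and kappa are represented by types L and K of that
   cardinality, so that K -> L is the set of maps from kappa to lambda. *)

(* In a play f, player ONE makes the moves of even index and player TWO those
   of odd index. A strategy reads the list of all moves made so far; its values
   at positions where the opponent is to move are irrelevant. *)
Section Games.
Variable M : Type.

Definition play := nat -> M.
Definition strategy := seq M -> M.

Definition follows_one (s : strategy) (f : play) : Prop :=
  forall n, f n.*2 = s (mkseq f n.*2).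

Definition follows_two (s : strategy) (f : play) : Prop :=
  forall n, f n.*2.+1 = s (mkseq f n.*2.+1).

(* A game with moves in M is given by the set W of plays won by ONE; TWO wins
   all the others. *)
Definition one_has_winning_strategy (W : set play) : Prop :=
  exists s : strategy, forall f : play, follows_one s f -> W f.

Definition two_has_winning_strategy (W : set play) : Prop :=
  exists s : strategy, forall f : play, follows_two s f -> ~ W f.

Definition determined (W : set play) : Prop :=
  one_has_winning_strategy W \/ two_has_winning_strategy W.

End Games.

Definition GS (L : Type) (A : set (nat -> L)) (K : Type) : set (play (K -> L)) :=
  [set f | exists a : K, A (fun n => f n a)].
Arguments GS : clear implicits.

(* The classical game is the case kappa = 1. *)
Definition GS1 (L : Type) (A : set (nat -> L)) : set (play (unit -> L)) :=
  GS L A unit.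
Arguments GS1 : clear implicits.

Definition GS_determinacy (L K : Type) : Prop :=
  forall A : set (nat -> L), determined (GS L A K).

Definition LG (L K : Type) : set (play (K -> L)) :=
  [set f | forall S : set (nat -> L),
     ~ two_has_winning_strategy (GS1 L S) ->
     exists xi : K, S (fun n => f n xi)].
Arguments LG : clear implicits.

Definition ONE_wins_LG (L K : Type) : Prop :=
  one_has_winning_strategy (LG L K).

(* Main.v *)
Require Import Defs.
From mathcomp Require Import all_boot.
From mathcomp Require Import mathcomp_extra boolp classical_sets functions.
From mathcomp Require Import cardinality.

(** The proof splits on whether TWO wins the classical game on [A]. If not,
    [A] is one of the sets [S] that ONE's winning strategy in the Laver game
    has to meet in every play, so that same strategy wins [GS L A K] for ONE.
    If so, TWO wins [GS L A K] by running the classical strategy on all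
    coordinates in parallel ([two_wins_GS_of_GS1]): ONE would need a single
    coordinate whose play lies in [A], and TWO wins on each of them. *)

(** The coordinates of a move are chosen independently, so that TWO can answer
    at coordinate [a] by looking only at the coordinates [a] of past moves. *)
Lemma two_wins_GS_of_GS1 (L K : Type) (A : set (nat -> L)) :
  two_has_winning_strategy (GS1 L A) -> two_has_winning_strategy (GS L A K).
Proof.
move=> [s s_wins].
exists (fun moves a => s (map (fun (g : K -> L) (_ : unit) => g a) moves) tt).
move=> f f_follows [a Aa].
apply: (s_wins (fun n _ => f n a)); last by exists tt.
by move=> n; apply/funext => -[]; rewrite f_follows /mkseq -map_comp.
Qed.

Theorem theorem6 (L K : Type)
    (hL : (`I_2 #<= [set: L])%classic%card) (hK : (`I_1 #<= [set: K])%classic%card) :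
  ONE_wins_LG L K -> GS_determinacy L K.
Proof.
move=> [s s_wins] A.
have [two_wins|not_two_wins] := pselect (two_has_winning_strategy (GS1 L A)).
  by right; apply: two_wins_GS_of_GS1.
by left; exists s => f f_follows; apply: s_wins f_follows A not_two_wins.
Qed.
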